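(* Let $s>1/3$ and $0<\gamma<1/3$, and let $\theta$ be a real constant such that $$-\tfrac43<\theta<2(s-1)\qquad\text{and}\qquad -\tfrac43<\theta<-4\gamma.$$ Consider the system $$\frac{da_j}{dt}=2^{j}a_{j-1}^2-2^{j+1}a_ja_{j+1}-2^{2\gamma j}a_j,\qquad j\ge 0,\quad a_{-1}\equiv 0.$$ There exists a constant $C=C(s,\gamma,\theta)>0$ such that, whenever real initial data $(a_j(0))_{j\ge 0}$ with $\sum_{j\ge 0}2^{2sj}a_j(0)^2<\infty$ satisfy $$\sum_{j=0}^\infty 2^{j(\theta+1)}a_j(0)>C,$$ there is finite-time blow-up in $H^s$-norm: for every solution $a(t)=(a_j(t))_{j\ge 0}$ on $[0,\infty)$ with this initial data, the function $t\mapsto\|a(t)\|_s^2$ is not locally integrable on $[0,\infty)$.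
   Context: The $H^s$-norm of a real sequence $a=(a_0,a_1,\dots)$ is given by $\|a\|_s^2:=\sum_{j=0}^\infty 2^{2sj}a_j^2\in[0,\infty]$. A solution on $[0,\infty)$ is a sequence of real-valued functions $a(t)=(a_j(t))_{j\ge 0}$, each continuously differentiable on $[0,\infty)$ (one-sided derivative at $0$), satisfying the infinite system of ODEs for all $t\ge 0$ and $j\ge 0$, with the boundary convention $a_{-1}(t)\equiv 0$, and taking the given initial values at $t=0$. ''Not locally integrable on $[0,\infty)$'' means that $\int_0^T\|a(t)\|_s^2\,dt=\infty$ for some finite $T>0$. *)

(* Defs.v *)
From HB Require Import structures.
From mathcomp Require Import all_boot all_order all_algebra.
From mathcomp Require Import all_classical all_reals all_analysis.
Set Implicit Arguments.
Unset Strict Implicit.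
Unset Printing Implicit Defensive.
Import Order.TTheory GRing.Theory Num.Theory.
Import numFieldNormedType.Exports.
Local Open Scope classical_set_scope.
Local Open Scope ring_scope.

Definition Hs_normsq (R : realType) (s : R) (a : nat -> R) : \bar R :=
  (\sum_(0 <= j <oo) (2 `^ (2 * s * j%:R) * a j ^+ 2)%:E)%E.

(* The difference quotient only sees arguments u >= 0 with u != t, so this is
   the usual derivative at t > 0 and the right derivative at t = 0; values of f
   at negative arguments are irrelevant. *)
Definition has_derivative_nneg (R : realType) (f : R -> R) (t l : R) : Prop :=
  (f u - f t) / (u - t) @[u --> within `[0, +oo[ t^'] --> l.

Definition C1_nneg (R : realType) (f f' : R -> R) : Prop :=
  (forall t, 0 <= t -> has_derivative_nneg f t (f' t)) /\
  {within `[0, +oo[, continuous f'}.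

(* Entry of index j - 1, with the convention a_{-1} = 0. *)
Definition prev_entry (R : realType) (a : nat -> R) (j : nat) : R :=
  if j is j'.+1 then a j' else 0.

Definition dyadic_rhs (R : realType) (gamma : R) (a : nat -> R) (j : nat) : R :=
  2 ^+ j * prev_entry a j ^+ 2
  - 2 ^+ j.+1 * a j * a j.+1
  - 2 `^ (2 * gamma * j%:R) * a j.

Definition dyadic_solution (R : realType) (gamma : R) (a0 : nat -> R)
    (a : nat -> R -> R) : Prop :=
  (forall j, a j 0 = a0 j) /\
  exists a' : nat -> R -> R,
    (forall j, C1_nneg (a j) (a' j)) /\
    (forall j t, 0 <= t -> a' j t = dyadic_rhs gamma (a ^~ t) j).

Definition not_locally_integrable_nneg (R : realType) (F : R -> \bar R) : Prop :=
  exists T : R, 0 < T /\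
    (\int[lebesgue_measure]_(t in `[0%R, T]) F t = +oo)%E.

(* Main.v *)
Require Import Defs.
From HB Require Import structures.
From mathcomp Require Import all_boot all_order all_algebra.
From mathcomp Require Import all_classical all_reals all_analysis.
From mathcomp Require Import ring lra.
Set Implicit Arguments.
Unset Strict Implicit.
Unset Printing Implicit Defensive.
Import Order.TTheory GRing.Theory Num.Theory.
Import numFieldNormedType.Exports.
Local Open Scope classical_set_scope.
Local Open Scope ring_scope.

(* With alpha = 2^theta, set J_N = sum_{j < N} (2 alpha)^j a_j and
   Q_N = sum_{j < N} (4 alpha)^j a_j^2.  By AM-GM, the condition theta > -4/3
   makes the quadratic terms of J_N' at least delta Q_N with delta > 0, up to a
   boundary term g_N involving only the modes N - 1 and N, while the conditions
   theta < -4 gamma and theta < 0 let Q_N absorb the dissipation and dominate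
   J_N^2.  Hence J_N' >= kappa J_N^2 - c0 - g_N.  Since theta + 2 < 2 s, local
   integrability of the H^s norm makes the integral of g_N over [0, T] tend to
   0 as N grows, so that for large N the finite sum J_N plus the primitive of
   g_N satisfies a Riccati inequality that blows up before T. *)

(** * Algebraic inequalities for the truncated sums *)

(* Induction on N works because the flux out of mode N is kept in the boundary
   term; [p] is [a] shifted by one, with the convention a_{-1} = 0. *)
Lemma energy_flux_lower_bound (R : realFieldType) (alpha beta nu : R)
    (a p : nat -> R) (N : nat) :
  0 < alpha -> 0 < nu -> nu ^+ 2 * (4 * alpha) = 1 -> 2 * nu < 4 * alpha ->
  p 0%N = 0 -> (forall j, p j.+1 = a j) ->
  let delta := 4 * alpha - 2 * nu in
  delta / 2 * (\sum_(j < N) (4 * alpha) ^+ j * a j ^+ 2)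
    - (2 * delta)^-1 * (\sum_(j < N) (alpha * beta ^+ 2) ^+ j)
    - ((4 * alpha) ^+ N * p N ^+ 2 + nu * ((4 * alpha) ^+ N * a N ^+ 2))
  <= \sum_(j < N) (2 * alpha) ^+ j
       * (2 ^+ j * p j ^+ 2 - 2 ^+ j.+1 * a j * a j.+1 - beta ^+ j * a j).
Proof.
move=> alpha0 nu0 nualpha nult p0 pS /=; set delta := 4 * alpha - 2 * nu.
have delta0 : 0 < delta by rewrite subr_gt0.
elim: N => [|N IH].
  rewrite /= !big_ord0 p0 !expr0 !mulr0 subr0 sub0r expr0n mulr0 add0r mul1r.
  by rewrite oppr_le0 mulr_ge0 ?sqr_ge0// ltW.
rewrite !big_ord_recr/= pS; apply: le_trans (lerD IH (lexx _)); rewrite -/delta.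
have pow4 j : (4 * alpha) ^+ j = (2 ^+ j) ^+ 2 * alpha ^+ j.
  by rewrite exprMn -exprM mulnC exprM -natrX.
have -> : (4 * alpha) ^+ N.+1 = (2 ^+ N) ^+ 2 * alpha ^+ N * (4 * alpha).
  by rewrite exprSr pow4.
rewrite pow4 [2 ^+ N.+1]exprS.
rewrite [(2 * alpha) ^+ N]exprMn [(alpha * beta ^+ 2) ^+ N]exprMn.
rewrite [(beta ^+ 2) ^+ N]exprAC.
set S1 := \sum_(j < N) _ ; set S2 := \sum_(j < N) _.
set u := 2 ^+ N; set v := alpha ^+ N; set b := beta ^+ N.
set P := p N; set A := a N; set B := a N.+1.
have v0 : 0 <= v by rewrite exprn_ge0 ?ltW.
(* The inductive step is the sum of two multiples of squares. *)
have h1 : 0 <= u ^+ 2 * v * (nu * A ^+ 2 - 2 * A * B + 4 * alpha * nu * B ^+ 2).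
  have -> : nu * A ^+ 2 - 2 * A * B + 4 * alpha * nu * B ^+ 2
      = nu * (A - 4 * alpha * nu * B) ^+ 2.
    (* The factor [nu ^+ 2 * (4 * alpha)], which equals 1, is inserted so that the square becomes a
       polynomial identity. *)
    transitivity (nu * A ^+ 2 - 2 * (nu ^+ 2 * (4 * alpha)) * A * B +
        (nu ^+ 2 * (4 * alpha)) * 4 * alpha * nu * B ^+ 2); last by ring.
    by rewrite nualpha; ring.
  exact: mulr_ge0 (mulr_ge0 (sqr_ge0 _) v0) (mulr_ge0 (ltW nu0) (sqr_ge0 _)).
have h2 d : 0 < d -> 0 <= v * (d / 2 * u ^+ 2 * A ^+ 2 - u * b * A + (2 * d)^-1 * b ^+ 2).
  move=> d0; have -> : d / 2 * u ^+ 2 * A ^+ 2 - u * b * A + (2 * d)^-1 * b ^+ 2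
      = (2 * d)^-1 * (d * u * A - b) ^+ 2.
    by field; rewrite lt0r_neq0.
  by rewrite mulr_ge0// mulr_ge0 ?sqr_ge0// invr_ge0 mulr_ge0// ltW.
rewrite -subr_ge0; have := addr_ge0 h1 (h2 _ delta0); congr (0 <= _).
have -> : delta / 2 = 2 * alpha - nu by rewrite /delta; field.
by ring.
Qed.

(** Cauchy-Schwarz for the splitting of (2 alpha)^j a_j into alpha^(j/2) and alpha^(j/2) 2^j a_j,
    carried out without square roots. *)
Lemma weighted_sum_sqr_le (R : realFieldType) (alpha K : R) (a : nat -> R)
    (N : nat) :
  0 < alpha -> 0 < K -> \sum_(j < N) alpha ^+ j <= K ->
  (\sum_(j < N) (2 * alpha) ^+ j * a j) ^+ 2
    <= K * \sum_(j < N) (4 * alpha) ^+ j * a j ^+ 2.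
Proof.
move=> alpha0 K0 leK.
set J := \sum_(j < N) _ * a j; set Q := \sum_(j < N) _ * a j ^+ 2.
(* Summing alpha^j (2^j a_j - L)^2 >= 0, with the optimal L = J / K. *)
have h L : 2 * L * J - L ^+ 2 * (\sum_(j < N) alpha ^+ j) <= Q.
  rewrite /J /Q !mulr_sumr -sumrB ler_sum// => j _; rewrite -subr_ge0.
  have -> : (4 * alpha) ^+ j = (2 ^+ j) ^+ 2 * alpha ^+ j.
    by rewrite exprMn -exprM mulnC exprM -natrX.
  have <- : alpha ^+ j * (2 ^+ j * a j - L) ^+ 2 =
      (2 ^+ j) ^+ 2 * alpha ^+ j * a j ^+ 2 -
      (2 * L * ((2 * alpha) ^+ j * a j) - L ^+ 2 * alpha ^+ j).
    by rewrite exprMn; ring.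
  by rewrite mulr_ge0 ?sqr_ge0// exprn_ge0// ltW.
rewrite mulrC -ler_pdivrMr//; apply: le_trans (h (J / K)).
apply: (@le_trans _ _ (2 * (J / K) * J - (J / K) ^+ 2 * K)).
  by rewrite le_eqVlt; apply/orP; left; apply/eqP; field; rewrite lt0r_neq0.
by rewrite lerD2l lerN2 ler_wpM2l// sqr_ge0.
Qed.

Lemma sum_geometric_le (R : realFieldType) (x : R) (N : nat) :
  0 <= x < 1 -> \sum_(j < N) x ^+ j <= (1 - x)^-1.
Proof.
move=> /andP[x0 x1]; rewrite -div1r ler_pdivlMr ?subr_gt0// mulrC.
have -> : (1 - x) * \sum_(j < N) x ^+ j = 1 - x ^+ N.
  by rewrite -opprB mulNr -subrX1 opprB.
by rewrite gerBl exprn_ge0.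
Qed.

(** * Derivatives on the half-line *)

(** At t > 0, increments h with |h| < t keep h + t in the half-line, so the restriction to [0, +oo[
    is harmless. *)
Lemma has_derivative_nneg_is_derive (R : realType) (f : R -> R) (t l : R) :
  0 < t -> has_derivative_nneg f t l -> is_derive t 1 f l.
Proof.
move=> t0 fl.
have lim : h^-1 *: (f (h *: 1 + t) - f t) @[h --> 0^'] --> l.
  apply/cvgrPdist_lt => e e0; move/cvgrPdist_lt: fl => /(_ e e0).
  rewrite /within/= => -[d/= d0 hd]; exists (Num.min d t) => /=.
    by rewrite lt_min d0.
  move=> h /=; rewrite sub0r normrN lt_min => /andP[hd1 ht] h0.
  have := hd (h + t).
  rewrite /ball_ /= opprD addrCA subrr addr0 normrN.
  rewrite in_itv/= andbT addrK.
  have ht0 : 0 <= h + t by move: ht; rewrite ltr_norml => /andP[? ?]; lra.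
  rewrite scaler1 [_ *: _]mulrC; apply => //.
  by rewrite -subr_eq0 addrK.
by apply: DeriveDef; [apply/cvg_ex; exists l|exact/cvg_lim].
Qed.

Lemma has_derivative_nneg_cvg_right (R : realType) (f : R -> R) (l : R) :
  has_derivative_nneg f 0 l -> f x @[x --> 0^'+] --> f 0.
Proof.
move=> fl.
have quot : (f u - f 0) / (u - 0) @[u --> 0^'+] --> l.
  apply: cvg_trans fl; apply: cvg_app => A; rewrite /within/= => -[d/= d0 hd].
  exists d => //= x xd x0; apply: (hd x xd); first by rewrite (gt_eqF x0).
  by rewrite in_itv/= andbT ltW.
have id0 : u @[u --> (0:R)^'+] --> (0:R).
  exact: cvg_at_right_filter.
have : (f u - f 0) / (u - 0) * u + f 0 @[u --> 0^'+] --> l * 0 + f 0.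
  by apply: cvgD; [exact: cvgM quot id0|exact: cvg_cst].
rewrite mulr0 add0r; apply: cvg_trans; apply: near_eq_cvg.
by near=> u; rewrite /= subr0 divfK ?subrK// gt_eqF.
Unshelve. all: by end_near. Qed.

Lemma C1_nneg_continuous (R : realType) (f f' : R -> R) (T : R) :
  0 < T -> C1_nneg f f' -> {within `[0, T], continuous f}.
Proof.
move=> T0 [df _].
have cf t : 0 < t -> {for t, continuous f}.
  move=> t0; apply/differentiable_continuous/derivable1_diffP.
  by case: (has_derivative_nneg_is_derive t0 (df _ (ltW t0))).
apply/(continuous_within_itvP _ T0); split.
- by move=> t; rewrite in_itv/= => /andP[t0 _]; exact: cf.
- exact: has_derivative_nneg_cvg_right (df 0 (lexx 0)).
- exact/cvg_at_left_filter/cf.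
Qed.

(** * Blow-up for Riccati inequalities *)

(** The differential inequality is only assumed where z >= C, so z is first shown never to leave the
    region z > C. Then 1/z + k t is nonincreasing, and 1/z(T) <= 1/z(0) - k T < 1/C - k T <= 0
    contradicts z(T) > 0. *)
Lemma riccati_blowup (R : realType) (z : R -> R) (k C T : R) :
  0 < k -> 0 < C -> 1 <= k * C * T -> {within `[0, T], continuous z} ->
  (forall t : R, t \in `]0, T[%R -> derivable z t 1) ->
  (forall t : R, t \in `]0, T[%R -> C <= z t -> k * z t ^+ 2 <= z^`()%classic t) ->
  C < z 0 -> False.
Proof.
move=> k0 C0 kCT cz dz z' z0.
have T0 : 0 < T.
  rewrite ltNge; apply/negP => T0.
  by have := mulr_ge0_le0 (ltW (mulr_gt0 k0 C0)) T0; lra.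
have zC (t : R) : t \in `[0, T]%R -> C < z t.
  move=> tT; rewrite ltNge; apply/negP => ztC.
  have [t0 tleT] : 0 <= t /\ t <= T by move: tT; rewrite in_itv/= => /andP.
  (* First-exit argument: up to s = inf A the function z is nondecreasing, so z(s) >= z(0) > C. By
     continuity z > C on some [s, s + d[, which makes s + d a lower bound of A. *)
  pose A := [set x : R | x \in `[0, T]%R /\ z x <= C].
  have At : A t by [].
  have lbA : lbound A 0 by move=> x []; rewrite in_itv/= => /andP[].
  have infA : has_inf A by split; [exists t|exists 0].
  pose s := inf A.
  have s0 : 0 <= s by apply: lb_le_inf => //; exists t.
  have st : s <= t by apply: ge_inf => //; exists 0.
  have sT : s \in `[0, T]%R by rewrite in_itv/= s0 (le_trans st).
  have below (x : R) : 0 <= x < s -> C < z x.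
    move=> /andP[x0 xs]; rewrite ltNge; apply/negP => zxC.
    have : s <= x.
      apply: ge_inf; first by exists 0.
      split => //; rewrite in_itv/= x0/=; lra.
    lra.
  have zs : z 0 <= z s.
    have := @ger0_derive1_le_cc R z 0 s; apply => //.
    - by move=> x; rewrite in_itv/= => /andP[x0 xs]; apply: dz; rewrite in_itv/=; lra.
    - move=> x; rewrite in_itv/= => /andP[x0 xs]; apply: le_trans (z' x _ _).
      + by rewrite mulr_ge0 ?sqr_ge0// ltW.
      + by rewrite in_itv/=; lra.
      + by apply/ltW/below; lra.
    - by apply: continuous_subspaceW cz; apply: subset_itvl; rewrite bnd_simp; lra.
    - by rewrite in_itv/= lexx.
    - by rewrite in_itv/= lexx s0.
  have Csz : C < z s by lra.
  have : \forall x \near within `[0, T] (nbhs s), C < z x.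
    rewrite [within _ _]nbhs_subspace_in; last exact: sT.
    exact: cz s _ (lt_nbhsr Csz).
  rewrite /within/= => -[d/= d0 hd].
  have : s + d <= s.
    apply: lb_le_inf; first by exists t.
    move=> x [xT zxC]; rewrite leNgt; apply/negP => xsd.
    have sx : s <= x by apply: ge_inf => //; exists 0.
    have : C < z x.
      by apply: hd => //; rewrite /ball_/= distrC ger0_norm; lra.
    lra.
  lra.
have zinv : (z T)^-1 <= (z 0)^-1 - k * T.
  have zn0 (t : R) : t \in `[0, T]%R -> z t != 0 by move=> /zC; lra.
  pose w t := (z t)^-1 + k * t.
  have dw (t : R) : t \in `]0, T[%R -> is_derive t 1 w (- (z t) ^- 2 * z^`()%classic t + k).
    move=> tT; have tT' : t \in `[0, T]%R by move: tT; rewrite !in_itv/=; lra.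
    have /derivableP := dz t tT; rewrite -derive1E => dzt.
    have dV := is_deriveV (zn0 t tT') dzt.
    have dkt := is_deriveZ k (is_derive_id t 1).
    apply: is_derive_eq (is_deriveD dV dkt) _.
    by congr (_ + _); exact: mulr1.
  have wle := @ler0_derive1_le_cc R w 0 T.
  have : w T <= w 0.
    apply: wle.
    - by move=> x /dw[].
    - move=> x xT; rewrite derive1E (@derive_val _ _ _ _ _ _ _ (dw x xT)).
      have xT' : x \in `[0, T]%R by move: xT; rewrite !in_itv/=; lra.
      have zx := z' x xT (ltW (zC x xT')).
      rewrite mulNr addrC subr_le0 mulrC ler_pdivlMr//.
      by rewrite exprn_gt0// (lt_trans C0 (zC x xT')).
    - move/subspace_continuousP: cz => cz; apply/subspace_continuousP => x xT.
      apply: cvgD; first by apply: cvgV; [exact: zn0|exact: cz].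
      by apply: cvgM; [exact: cvg_cst|exact: cvg_within].
    - by rewrite in_itv/= lexx ltW.
    - by rewrite in_itv/= lexx ltW.
    - exact: ltW.
  by rewrite /w mulr0 addr0 lerBrDr.
have z00 : (z 0)^-1 < C^-1 by rewrite ltf_pV2// posrE; lra.
have : 0 < (z T)^-1.
  by rewrite invr_gt0; apply: lt_trans (zC T _); rewrite // in_itv/= lexx ltW.
have : C^-1 <= k * T by rewrite -div1r ler_pdivrMr//; lra.
lra.
Qed.

(** With G the primitive of g vanishing at 0, z = J + G satisfies z' >= kappa J^2 - c0. Where z >=
    C, the bound G <= C/2 gives J >= z/2, hence z' >= kappa z^2/4 - c0. Since c0 <= kappa C^2/8 <=
    kappa z^2/8, this leaves the rate kappa/8, the origin of the factors 8. *)
Lemma forced_riccati_blowup (R : realType) (J g : R -> R) (kappa c0 C T : R) :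
  0 < kappa -> 0 < C -> 8 * c0 <= kappa * C ^+ 2 -> 8 <= kappa * C * T ->
  {within `[0, T], continuous J} -> {within `[0, T], continuous g} ->
  (forall t, t \in `[0, T]%R -> 0 <= g t) ->
  \int[lebesgue_measure]_(t in `[0%R, T]) g t <= C / 2 ->
  (forall t, t \in `]0, T[%R -> derivable J t 1) ->
  (forall t, t \in `]0, T[%R ->
     kappa * J t ^+ 2 - c0 - g t <= J^`()%classic t) ->
  C < J 0 -> False.
Proof.
move=> kappa0 C0 c0C kCT cJ cg g0 intg dJ J' J0.
have T0 : 0 < T.
  rewrite ltNge; apply/negP => T0.
  by have := mulr_ge0_le0 (ltW (mulr_gt0 kappa0 C0)) T0; lra.
have ig : lebesgue_measure.-integrable `[0, T] (EFin \o g).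
  by apply: continuous_compact_integrable => //; exact: segment_compact.
pose G x := \int[lebesgue_measure]_(t in `[0%R, x]) g t.
have G0 : G 0 = 0 by rewrite /G set_itv1 Rintegral_set1.
have GC t : t \in `[0, T]%R -> G t <= C / 2.
  move=> tT; apply: le_trans intg.
  rewrite -subr_ge0 /G Rintegral_itvB//.
  - apply: Rintegral_ge0 => x /=; rewrite in_itv/= => /andP[tx xT]; apply: g0.
    by move: tT; rewrite !in_itv/=; lra.
  - by move: tT; rewrite in_itv/= bnd_simp => /andP[].
  - by move: tT; rewrite in_itv/= bnd_simp => /andP[].
have dG t : t \in `]0, T[%R -> is_derive t 1 G (g t).
  rewrite in_itv/= => /andP[t0 tT].
  have cgt : {for t, continuous g}.
    move/(continuous_within_itvP _ T0) : cg => [cg _ _].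
    by apply: cg; rewrite in_itv/= t0.
  have [dG <-] := continuous_FTC1_closed tT ig t0 cgt.
  by rewrite derive1E; exact/derivableP.
have cG : {within `[0, T], continuous G}.
  exact: (parameterized_integral_continuous (ltW T0) ig).
have dJG t : t \in `]0, T[%R -> is_derive t 1 (J + G) (J^`()%classic t + g t).
  move=> tT; apply: is_deriveD (dG t tT).
  by rewrite derive1E; exact/derivableP/dJ.
apply: (@riccati_blowup R (J + G) (kappa / 8) C T) => //.
- by rewrite divr_gt0.
- by lra.
- move/subspace_continuousP: cJ => cJ; move/subspace_continuousP: cG => cG.
  by apply/subspace_continuousP => x xT; apply: cvgD; [exact: cJ|exact: cG].
- by move=> t /dJG[].
- move=> t tT; rewrite derive1E (@derive_val _ _ _ _ _ _ _ (dJG t tT)).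
  have tT' : t \in `[0, T]%R by move: tT; rewrite !in_itv/=; lra.
  have GtC := GC t tT'; have := J' t tT.
  rewrite !fctE; set Jt := J t; set Gt := G t => h Cz.
  have h1 : (Jt + Gt) / 2 <= Jt by rewrite /Jt /Gt in GtC Cz *; lra.
  have h2 : ((Jt + Gt) / 2) ^+ 2 <= Jt ^+ 2.
    by rewrite lerXn2r// nnegrE; rewrite /Jt /Gt in GtC Cz h1 *; lra.
  have h3 : C ^+ 2 <= (Jt + Gt) ^+ 2.
    by rewrite lerXn2r// nnegrE ?ltW// (lt_le_trans C0).
  move: (ler_wpM2l (ltW kappa0) h2) (ler_wpM2l (ltW kappa0) h3).
  by rewrite expr_div_n; lra.
- by rewrite !fctE G0 addr0.
Qed.

(** * Vanishing of the boundary terms, and calculus for finite sums *)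

(** Nonnegativity allows exchanging sum and integral; each integral is then at most a tail of a
    convergent series. *)
Lemma Rintegral_term_cvg0 (R : realType) (h : nat -> R -> R) (T : R) :
  (forall j, {within `[0, T], continuous h j}) ->
  (forall j t, 0 <= h j t) ->
  (\int[lebesgue_measure]_(t in `[0%R, T]) \sum_(0 <= j <oo) (h j t)%:E < +oo)%E ->
  \int[lebesgue_measure]_(t in `[0%R, T]) h n t @[n --> \oo] --> (0 : R).
Proof.
move=> ch h0.
have ih j : lebesgue_measure.-integrable `[0, T] (EFin \o h j).
  by apply: continuous_compact_integrable => //; exact: segment_compact.
rewrite integral_nneseries//; last first.
- by move=> n x _; rewrite lee_fin.
- by move=> n; exact: (measurable_int _ (ih n)).
set I := fun n => (\int[lebesgue_measure]_(t in `[0%R, T]) (h n t)%:E)%E.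
move=> Ioo.
have I0 n : (0 <= I n)%E by apply: integral_ge0 => x _; rewrite lee_fin.
have := nneseries_tail_cvg Ioo (fun k _ => I0 k) => tail.
have I_cvg0 : I n @[n --> \oo] --> 0%E.
  apply: (squeeze_cvge _ (cvg_cst 0%E) tail).
  apply: nearW => n; rewrite I0/=.
  have := @nneseries_lim_ge R I predT n n.+1 (fun k _ _ => I0 k).
  by rewrite big_nat1.
exact: fine_cvg I_cvg0.
Qed.

Lemma ltr_powR2 (R : realType) (x y : R) : x < y -> 2 `^ x < 2 `^ y.
Proof.
move=> xy; rewrite /powR (gt_eqF (ltr0n _ 2)) ltr_expR ltr_pM2r// ln_gt0//.
by rewrite ltr1n.
Qed.

Lemma is_derive_weighted_sum (R : realType) (c : nat -> R) (f : nat -> R -> R)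
    (df : nat -> R) (t : R) (N : nat) :
  (forall j, is_derive t 1 (f j) (df j)) ->
  is_derive t 1 (fun u => \sum_(j < N) c j * f j u) (\sum_(j < N) c j * df j).
Proof.
move=> h.
rewrite (_ : (fun _ => _) = \sum_(j < N) (c j \*: f j)); last first.
  by apply/funext => u; rewrite fct_sumE.
by apply: is_derive_sum => j; exact: is_deriveZ.
Qed.

Lemma continuous_weighted_sum (R : realType) (A : set R) (c : nat -> R)
    (f : nat -> R -> R) (N : nat) :
  (forall j, {within A, continuous (f j)}) ->
  {within A, continuous (fun u => \sum_(j < N) c j * f j u)}.
Proof.
move=> cf; apply/subspace_continuousP => x Ax.
elim: N => [|N IH].
  by under eq_fun do rewrite big_ord0; exact: cvg_cst.
under eq_fun do rewrite big_ord_recr/=.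
apply: cvgD => //; apply: cvgM; first exact: cvg_cst.
by have /subspace_continuousP := cf N; exact.
Qed.

(** * Choice of constants and conclusion *)

Theorem corollary8 (R : realType) (s gamma theta : R)
    (hs : 1 / 3 < s)
    (hgamma : 0 < gamma < 1 / 3)
    (htheta_s : - (4 / 3) < theta < 2 * (s - 1))
    (htheta_gamma : - (4 / 3) < theta < - (4 * gamma)) :
  exists C : R, 0 < C /\
    forall a0 : nat -> R,
      (Hs_normsq s a0 < +oo)%E ->
      C < limn (series (fun j : nat => 2 `^ (j%:R * (theta + 1)) * a0 j)) ->
      forall a : nat -> R -> R,
        dyadic_solution gamma a0 a ->
        not_locally_integrable_nneg (fun t => Hs_normsq s (a ^~ t)).
Proof.
have two0 : (2 : R) != 0 by rewrite pnatr_eq0.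
have two_ge0 : (0 : R) <= 2 by rewrite ler0n.
have powD x y : 2 `^ (x + y) = 2 `^ x * 2 `^ y :> R.
  by rewrite powRD// two0 implybT.
have pow1 : 2 `^ 1 = 2 :> R by rewrite powRr1.
have pow0 : 2 `^ 0 = 1 :> R by exact: powRr0.
have pow_gt0 x : 0 < 2 `^ x :> R by rewrite powR_gt0// ltr0n.
have pow_ge0 x : 0 <= 2 `^ x :> R by exact: powR_ge0.
have powXn x (j : nat) : 2 `^ (x * j%:R) = (2 `^ x) ^+ j :> R.
  by rewrite powRrM powR_mulrn.
have [alpha alphaE] : exists x : R, x = 2 `^ theta by exists (2 `^ theta).
have [beta betaE] : exists x : R, x = 2 `^ (2 * gamma) by exists (2 `^ (2 * gamma)).
(* [nu] balances 2 a_j a_{j+1} <= nu a_j^2 + 4 alpha nu a_{j+1}^2, which needs 4 alpha nu^2 = 1.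
   Each mode is charged nu twice, once per neighbour, against a gain of 4 alpha; 2 nu < 4 alpha says
   exactly theta > -4/3. *)
have [nu nuE] : exists x : R, x = 2 `^ (- ((theta + 2) / 2)) by eexists.
have alpha0 : 0 < alpha by rewrite alphaE.
have nu0 : 0 < nu by rewrite nuE.
have E2 : 2 * alpha = 2 `^ (theta + 1) by rewrite powD pow1 mulrC alphaE.
have E4 : 4 * alpha = 2 `^ (theta + 2).
  by rewrite (_ : theta + 2 = theta + 1 + 1) ?powD ?pow1 -?alphaE; ring.
have alpha1 : alpha < 1 by rewrite alphaE -[ltRHS]pow0; apply: ltr_powR2; lra.
have Eab : alpha * beta ^+ 2 = 2 `^ (theta + 4 * gamma).
  by rewrite powD alphaE betaE -powXn; congr (_ * 2 `^ _); ring.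
have ab0 : 0 <= alpha * beta ^+ 2 by rewrite mulr_ge0 ?sqr_ge0 ?ltW.
have ab1 : alpha * beta ^+ 2 < 1 by rewrite Eab -[ltRHS]pow0; apply: ltr_powR2; lra.
have nualpha : nu ^+ 2 * (4 * alpha) = 1.
  by rewrite E4 nuE -powXn -powD -[RHS]pow0; congr (_ `^ _); field.
have nult : 2 * nu < 4 * alpha.
  by rewrite E4 nuE -[X in X * _]pow1 -powD; apply: ltr_powR2; lra.
(* This is where theta + 2 < 2 s enters: the energy weights are dominated by those of the H^s
   norm. *)
have weight_le (j : nat) : (4 * alpha) ^+ j <= 2 `^ (2 * s * j%:R).
  rewrite E4 -powXn; apply: ler_powR; first by rewrite ler1n.
  by rewrite ler_wpM2r//; lra.
pose delta := 4 * alpha - 2 * nu.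
have delta0 : 0 < delta by rewrite subr_gt0.
pose K1 := (1 - alpha)^-1; pose K2 := (1 - alpha * beta ^+ 2)^-1.
have K10 : 0 < K1 by rewrite invr_gt0 subr_gt0.
have K20 : 0 < K2 by rewrite invr_gt0 subr_gt0.
(* [c0] bounds the dissipation sum for every N, and [kappa] comes from J^2 <= K1 Q inserted in
   delta/2 Q. *)
pose c0 := (2 * delta)^-1 * K2; pose kappa := delta / (2 * K1).
have c00 : 0 < c0 by rewrite mulr_gt0// invr_gt0 mulr_gt0.
have kappa0 : 0 < kappa by rewrite divr_gt0// mulr_gt0.
(* The summand 1 gives C >= 1, hence kappa C^2 >= kappa (C - 1) = 8 c0; T is the time with kappa C T
   = 8. Neither depends on the data. *)
pose C := 8 * c0 / kappa + 1; pose T := 8 / (kappa * C).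
have C1 : 1 <= C by rewrite lerDr ltW// divr_gt0// mulr_gt0.
have C0 : 0 < C by lra.
have T0 : 0 < T by rewrite divr_gt0// mulr_gt0.
have kC : 8 * c0 <= kappa * C ^+ 2.
  have -> : 8 * c0 = kappa * (C - 1) by rewrite /C; field; rewrite lt0r_neq0.
  by rewrite ler_pM2l// expr2; have := ler_wpM2l (ltW C0) C1; lra.
exists C; split => // a0 _ Clim a [a_0 [a' [aC1 aE]]].
exists T; split => //; apply/eqP; rewrite -leye_eq leNgt; apply/negP => fin.
have ca j : {within `[0, T], continuous a j}.
  exact: C1_nneg_continuous (aC1 j).
have da j t : t \in `]0, T[%R -> is_derive t 1 (a j) (a' j t).
  rewrite in_itv/= => /andP[t0 _].
  by apply: has_derivative_nneg_is_derive => //; apply: (aC1 j).1; exact: ltW.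
pose h j t := 2 `^ (2 * s * j%:R) * a j t ^+ 2.
have h0 j t : 0 <= h j t by rewrite mulr_ge0 ?sqr_ge0.
have ch j : {within `[0, T], continuous h j}.
  apply/subspace_continuousP => x xT; apply: cvgM; first exact: cvg_cst.
  have /subspace_continuousP caj := ca j.
  by rewrite expr2; apply: cvgM; exact: caj.
have ih j : lebesgue_measure.-integrable `[0, T] (EFin \o h j).
  by apply: continuous_compact_integrable => //; exact: segment_compact.
have icZ c j : lebesgue_measure.-integrable `[0, T] (EFin \o (fun t => c * h j t)).
  apply: continuous_compact_integrable; first exact: segment_compact.
  apply/subspace_continuousP => x xT; apply: cvgM; first exact: cvg_cst.
  by have /subspace_continuousP := ch j; exact.
have h_cvg0 := Rintegral_term_cvg0 ch h0 fin.
(* Dominates the boundary term for N = n + 1: one factor 4 alpha is split off (4 alpha)^(n+1) a_n^2,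
   so that each weight matches the index of its mode. *)
pose g n t := 4 * alpha * h n t + nu * h n.+1 t.
have g_cvg0 : \int[lebesgue_measure]_(t in `[0%R, T]) g n t @[n --> \oo] --> 0.
  have -> : (fun n => \int[lebesgue_measure]_(t in `[0%R, T]) g n t) =
      (fun n => 4 * alpha * \int[lebesgue_measure]_(t in `[0%R, T]) h n t +
                nu * \int[lebesgue_measure]_(t in `[0%R, T]) h n.+1 t).
    apply/funext => n; rewrite RintegralD//.
    by congr (_ + _); apply: RintegralZl => //; exact: ih.
  rewrite -[X in _ --> X](addr0 0) -[X in X + _](mulr0 (4 * alpha)).
  rewrite -[X in _ + X](mulr0 nu).
  apply: cvgD; first by apply: cvgM => //; exact: cvg_cst.
  apply: cvgM; first exact: cvg_cst.
  by move: h_cvg0; rewrite -cvg_shiftS.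
set u := series _ in Clim.
(* A divergent series has [limn] equal to [point = 0] by convention. *)
have cu : cvgn u.
  apply: contrapT => /dvgP ulim; move: Clim; rewrite ulim.
  by move=> Clt0; have := lt_trans C0 Clt0; rewrite ltxx.
have u_gt : \forall n \near \oo, C < u n.+1.
  by move: (cu : u @ \oo --> _); rewrite -cvg_shiftS => /cvgr_gt; exact.
have g_lt : \forall n \near \oo, \int[lebesgue_measure]_(t in `[0%R, T]) g n t <= C / 2.
  apply: (cvgr_le _ g_cvg0). by rewrite divr_gt0.
(* One truncation serves both needs: [u n.+1] is the initial value of the sum [J] over modes 0 to n,
   and [g n] is its boundary term. *)
have [n [Cun gn]] := filter_ex (filterI u_gt g_lt).
pose J t := \sum_(j < n.+1) (2 * alpha) ^+ j * a j t.
have cg : {within `[0, T], continuous g n}.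
  apply/subspace_continuousP => x xT.
  have /subspace_continuousP c1 := ch n; have /subspace_continuousP c2 := ch n.+1.
  by apply: cvgD; apply: cvgM; [exact: cvg_cst|exact: c1|exact: cvg_cst|exact: c2].
have dJ t (tT : t \in `]0, T[%R) :
    is_derive t 1 J (\sum_(j < n.+1) (2 * alpha) ^+ j * a' j t).
  exact: (@is_derive_weighted_sum R (fun j => (2 * alpha) ^+ j) a _ t _
    (fun j => da j t tT)).
apply: (@forced_riccati_blowup R J (g n) kappa c0 C T) => //.
- have kC0 : kappa * C != 0 by rewrite lt0r_neq0// mulr_gt0.
  by rewrite /T mulrC divfK.
- exact: (@continuous_weighted_sum R _ (fun j => (2 * alpha) ^+ j) a).
- by move=> t _; rewrite addr_ge0// mulr_ge0// ?ltW// mulr_gt0.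
- by move=> t /dJ[].
- move=> t tT; rewrite derive1E (@derive_val _ _ _ _ _ _ _ (dJ t tT)).
  have t0 : 0 <= t by move: tT; rewrite in_itv/=; lra.
  set Q := \sum_(j < n.+1) (4 * alpha) ^+ j * a j t ^+ 2.
  have JQ : kappa * J t ^+ 2 <= delta / 2 * Q.
    have := @weighted_sum_sqr_le R alpha K1 (a ^~ t) n.+1 alpha0 K10.
    have -> : delta / 2 * Q = kappa * (K1 * Q).
      by rewrite /kappa; field; rewrite lt0r_neq0.
    rewrite ler_pM2l//; apply; apply: sum_geometric_le.
    by rewrite ltW.
  have flux := @energy_flux_lower_bound R alpha beta nu (a ^~ t)
    (prev_entry (a ^~ t)) n.+1 alpha0 nu0 nualpha nult erefl (fun=> erefl).
  have -> : \sum_(j < n.+1) (2 * alpha) ^+ j * a' j t =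
      \sum_(j < n.+1) (2 * alpha) ^+ j *
        (2 ^+ j * prev_entry (a ^~ t) j ^+ 2 - 2 ^+ j.+1 * a j t * a j.+1 t
         - beta ^+ j * a j t).
    by apply: eq_bigr => j _; rewrite aE// /dyadic_rhs powXn betaE.
  apply: le_trans flux; rewrite -/delta -/Q.
  apply: lerB; first apply: lerB => //.
    apply: ler_wpM2l; first by rewrite invr_ge0 ltW// mulr_gt0.
    by apply: sum_geometric_le; rewrite ab0.
  have hle j : (4 * alpha) ^+ j * a j t ^+ 2 <= h j t.
    by apply: ler_wpM2r (weight_le j); exact: sqr_ge0.
  apply: lerD; last exact: ler_wpM2l (ltW nu0) _ _ (hle n.+1).
  rewrite exprS -mulrA; apply: ler_wpM2l (hle n).
  by rewrite mulr_ge0// ltW.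
- move: Cun; rewrite /u /series/= big_mkord /J; congr (_ < _).
  by apply: eq_bigr => j _; rewrite a_0 mulrC mulrC E2 -powXn [_ * j%:R]mulrC.
Qed.
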